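(* Let $n,m\ge 1$ and $s\in(0,n)$ be integers, let $f\colon\mathbb{R}^n\to\mathbb{R}$ and $\phi=(\phi_1,\dots,\phi_m)\colon\mathbb{R}^n\to\mathbb{R}^m$ be of class $C^1$, let $D=\{0_{\mathbb{R}^m}\}$, and consider the problem of minimizing $f$ over $\Omega=\{x\in\mathbb{R}^n : \phi(x)\in D,\ \|x\|_0\le s\}$. Suppose that $\bar x\neq 0$ is a local optimal solution of this problem and that $f$ and $\phi$ are of class $C^{1,1}$ around $\bar x$. (i) If the RRCQ holds at $\bar x$ and $\|\bar x\|_0=s$, then for each $u\in T_\Omega(\bar x)$ and each $\bar\lambda\in\Lambda^C(\bar x)$ there exists $z\in\partial^2L(\bar x,\bar\lambda)(u)$ such that $\langle z,u\rangle\ge 0$. (ii) If $\bar\lambda$ is the unique Lagrange multiplier in $\Lambda^S(\bar x)$ and the RSRCQ holds at the pair $(\bar x,\bar\lambda)$, then for each $u\in T_\Omega(\bar x)$ there exists $z\in\partial^2L(\bar x,\bar\lambda)(u)$ such that $\langle z,u\rangle\ge 0$. (iii) If $\bar x$ is an isolated local solution of order $2$ of the problem, $\bar\lambda$ is the unique Lagrange multiplier in $\Lambda^S(\bar x)$, and the RSRCQ holds at $\bar x$ with respect to $\bar\lambda$ (i.e. at the pair $(\bar x,\bar\lambda)$), then for each $u\in T_\Omega(\bar x)\setminus\{0\}$ there exists $z\in\partial^2L(\bar x,\bar\lambda)(u)$ such that $\langle z,u\rangle>0$.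
   Context: Notation: $\|x\|_0$ is the number of nonzero components of $x$; $\mathcal{S}=\{x\in\mathbb{R}^n:\|x\|_0\le s\}$; $\bar J=\Gamma(\bar x)=\{i:\bar x_i\neq 0\}$; for $J\subset\{1,\dots,n\}$, $\mathbb{R}^n_J=\mathrm{span}\{e_i:i\in J\}$ with $e_i$ the $i$-th unit vector. $\nabla\phi(\bar x)$ denotes the Jacobian of $\phi$ at $\bar x$. Solutions: $\bar x\in\Omega$ is a local optimal solution if there is a neighborhood $U$ of $\bar x$ with $f(x)\ge f(\bar x)$ for all $x\in\Omega\cap U$; it is an isolated local solution of order $2$ if there are $c>0$ and a neighborhood $U$ of $\bar x$ with $f(x)\ge f(\bar x)+\frac12 c\|x-\bar x\|^2$ for all $x\in\Omega\cap U$. Smoothness: a real function is of class $C^{1,1}$ around $\bar x$ if on some open neighborhood of $\bar x$ it is Fréchet differentiable with locally Lipschitz gradient; for vector-valued maps this is required of each component. Tangent and normal cones: for $X\subset\mathbb{R}^n$ and $\bar x\in X$, the contingent cone is $T_X(\bar x)=\{u:\exists t_k\to0^+,\ \exists u_k\to u,\ \bar x+t_ku_k\in X\ \forall k\}$. The Fréchet normal cone is $\widehat N_X(\bar x)=\{v:\limsup_{x\to\bar x,\,x\in X}\langle v,x-\bar x\rangle/\|x-\bar x\|\le0\}$. The limiting normal cone $N_X(\bar x)$ is the set of all limits of sequences $v_k\in\widehat N_X(x_k)$ with $x_k\to\bar x$, $x_k\in X$. The Clarke normal cone is $N^C_X(\bar x)=\mathrm{cl}\,\mathrm{co}\,N_X(\bar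 x)$. For convex $X$, $N_X$ is the normal cone of convex analysis. Lagrangian and multipliers: $L(x,\lambda)=f(x)+\langle\lambda,\phi(x)\rangle$ for $(x,\lambda)\in\mathbb{R}^n\times\mathbb{R}^m$; $\Lambda^S(\bar x)=\{\lambda\in\mathbb{R}^m_+:-\nabla_xL(\bar x,\lambda)\in\widehat N_{\mathcal S}(\bar x),\ \lambda\in N_D(\phi(\bar x))\}$, $\Lambda^C(\bar x)=\{\lambda\in\mathbb{R}^m_+:-\nabla_xL(\bar x,\lambda)\in N^C_{\mathcal S}(\bar x),\ \lambda\in N_D(\phi(\bar x))\}$. Constraint qualifications: the restricted Robinson constraint qualification (RRCQ) holds at $\bar x$ if $0\in\mathrm{int}\{\phi(\bar x)+\nabla\phi(\bar x)\mathbb{R}^n_{\bar J}-D\}$. The restricted strict Robinson constraint qualification (RSRCQ) holds at the pair $(\bar x,\bar\lambda)$, where $\bar\lambda\in N_D(\phi(\bar x))$, if $0\in\mathrm{int}\{\phi(\bar x)+\nabla\phi(\bar x)\mathbb{R}^n_{\bar J}-D_0\}$ with $D_0=\{y\in D:\langle\bar\lambda,y-\phi(\bar x)\rangle=0\}$. Second-order subdifferential: for $\psi$ of class $C^{1,1}$ around $\bar x$, the limiting (Mordukhovich) second-order subdifferential is $\partial^2\psi(\bar x)(u)=\{w\in\mathbb{R}^n:(w,-u)\in N_{\mathrm{gph}\,\nabla\psi}(\bar x,\nabla\psi(\bar x))\}$, which equals $\partial\langle u,\nabla\psi\rangle(\bar x)$, where $\partial\varphi(\bar x)=\{v:(v,-1)\in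 N_{\mathrm{epi}\,\varphi}(\bar x,\varphi(\bar x))\}$ is the limiting subdifferential. $\partial^2L(\bar x,\bar\lambda)(u)$ means $\partial^2\psi(\bar x)(u)$ for $\psi=L(\cdot,\bar\lambda)$. *)

(* Defs.v *)
From HB Require Import structures.
From mathcomp Require Import all_boot all_order all_algebra.
From mathcomp Require Import all_classical all_reals all_analysis.

Set Implicit Arguments.
Unset Strict Implicit.
Unset Printing Implicit Defensive.

Import Order.TTheory GRing.Theory Num.Theory.
Import numFieldNormedType.Exports.

Local Open Scope classical_set_scope.
Local Open Scope ring_scope.

(* Elements of R^n are row vectors 'rV[R]_n. The library norm `|x| on them is
   the sup norm: it is used only through the topology and the notion of
   Lipschitz map, which do not depend on the norm; wherever a norm occurs in a
   formula, it is the Euclidean norm enorm below. *)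

Definition dotv (R : realType) (n : nat) (u v : 'rV[R]_n) : R :=
  \sum_(i < n) u 0 i * v 0 i.

Definition enorm (R : realType) (n : nat) (u : 'rV[R]_n) : R :=
  Num.sqrt (dotv u u).

Definition supp (R : realType) (n : nat) (x : 'rV[R]_n) : {set 'I_n} :=
  [set i | x 0 i != 0]%SET.

Definition l0 (R : realType) (n : nat) (x : 'rV[R]_n) : nat := #|supp x|.

Definition sparse (R : realType) (n s : nat) : set 'rV[R]_n :=
  [set x | (l0 x <= s)%N].

Definition coord_space (R : realType) (n : nat) (J : {set 'I_n}) :
    set 'rV[R]_n :=
  [set x | x \in <<[seq (delta_mx 0%R i : 'rV[R]_n) | i <- enum J]>>%VS].

Definition contingent_cone (R : realType) (n : nat) (X : set 'rV[R]_n)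
    (x : 'rV[R]_n) : set 'rV[R]_n :=
  [set u | exists (t : nat -> R) (v : nat -> 'rV[R]_n),
     [/\ forall k, 0 < t k, t @ \oo --> (0 : R), v @ \oo --> u
       & forall k, X (x + t k *: v k)]].

(* The upper limit is taken along the punctured neighbourhoods of x in X;
   it is -oo when x is isolated in X, so that every v is then normal. *)
Definition frechet_normal (R : realType) (n : nat) (X : set 'rV[R]_n)
    (x : 'rV[R]_n) : set 'rV[R]_n :=
  [set v | (limf_esup
      (fun y : 'rV[R]_n => (dotv v (y - x)%R / enorm (y - x)%R)%:E)
      (within X x^') <= 0)%E].

Definition limiting_normal (R : realType) (n : nat) (X : set 'rV[R]_n)
    (x : 'rV[R]_n) : set 'rV[R]_n :=
  [set v | exists (y w : nat -> 'rV[R]_n),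
     [/\ forall k, X (y k), y @ \oo --> x,
         forall k, frechet_normal X (y k) (w k) & w @ \oo --> v]].

Definition clarke_normal (R : realType) (n : nat) (X : set 'rV[R]_n)
    (x : 'rV[R]_n) : set 'rV[R]_n :=
  closure (smallest (@convex_set R 'rV[R]_n) (limiting_normal X x)).

(* The Frechet gradient, at the points where psi is differentiable. *)
Definition grad (R : realType) (n : nat) (psi : 'rV[R]_n -> R)
    (x : 'rV[R]_n) : 'rV[R]_n :=
  \row_(i < n) 'd psi x (delta_mx 0 i).

Definition component (R : realType) (n m : nat) (phi : 'rV[R]_n -> 'rV[R]_m)
    (j : 'I_m) : 'rV[R]_n -> R := fun x => phi x 0 j.

Definition C1 (R : realType) (n : nat) (psi : 'rV[R]_n -> R) : Prop :=
  (forall x, differentiable psi x) /\ continuous (grad psi).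

Definition C1_vec (R : realType) (n m : nat) (phi : 'rV[R]_n -> 'rV[R]_m) :
    Prop :=
  forall j, C1 (component phi j).

Definition C11_around (R : realType) (n : nat) (psi : 'rV[R]_n -> R)
    (xb : 'rV[R]_n) : Prop :=
  exists U : set 'rV[R]_n,
    [/\ open U, U xb, forall x, U x -> differentiable psi x
      & forall x, U x -> exists2 V : set 'rV[R]_n, nbhs x V &
          [lipschitz grad psi y | y in V]].

Definition C11_vec_around (R : realType) (n m : nat)
    (phi : 'rV[R]_n -> 'rV[R]_m) (xb : 'rV[R]_n) : Prop :=
  forall j, C11_around (component phi j) xb.

Definition feasible (R : realType) (n m s : nat) (phi : 'rV[R]_n -> 'rV[R]_m)
    (D : set 'rV[R]_m) : set 'rV[R]_n :=
  [set x | D (phi x) /\ (l0 x <= s)%N].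

Definition local_solution (R : realType) (n : nat) (f : 'rV[R]_n -> R)
    (Omega : set 'rV[R]_n) (xb : 'rV[R]_n) : Prop :=
  Omega xb /\ \forall x \near xb, Omega x -> f xb <= f x.

Definition isolated_solution2 (R : realType) (n : nat) (f : 'rV[R]_n -> R)
    (Omega : set 'rV[R]_n) (xb : 'rV[R]_n) : Prop :=
  Omega xb /\ exists2 c : R, 0 < c &
    \forall x \near xb, Omega x ->
      f xb + 2^-1 * c * enorm (x - xb) ^+ 2 <= f x.

Definition lagrangian (R : realType) (n m : nat) (f : 'rV[R]_n -> R)
    (phi : 'rV[R]_n -> 'rV[R]_m) (lam : 'rV[R]_m) (x : 'rV[R]_n) : R :=
  f x + dotv lam (phi x).

Definition LambdaS (R : realType) (n m s : nat) (f : 'rV[R]_n -> R)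
    (phi : 'rV[R]_n -> 'rV[R]_m) (D : set 'rV[R]_m) (xb : 'rV[R]_n) :
    set 'rV[R]_m :=
  [set lam : 'rV[R]_m | [/\ forall j, 0 <= lam 0 j,
     frechet_normal (@sparse R n s) xb (- grad (lagrangian f phi lam) xb)
   & limiting_normal D (phi xb) lam]].

Definition LambdaC (R : realType) (n m s : nat) (f : 'rV[R]_n -> R)
    (phi : 'rV[R]_n -> 'rV[R]_m) (D : set 'rV[R]_m) (xb : 'rV[R]_n) :
    set 'rV[R]_m :=
  [set lam : 'rV[R]_m | [/\ forall j, 0 <= lam 0 j,
     clarke_normal (@sparse R n s) xb (- grad (lagrangian f phi lam) xb)
   & limiting_normal D (phi xb) lam]].

(* Vectors being rows, the Jacobian 'J phi xb has size n x m and acts on the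
   right. *)
Definition linearized_set (R : realType) (n m : nat)
    (phi : 'rV[R]_n -> 'rV[R]_m) (D : set 'rV[R]_m) (xb : 'rV[R]_n) :
    set 'rV[R]_m :=
  [set z | exists h d : 'rV_ _, [/\ coord_space (supp xb) h, D d &
     z = phi xb + h *m 'J phi xb - d]].

Definition RRCQ (R : realType) (n m : nat) (phi : 'rV[R]_n -> 'rV[R]_m)
    (D : set 'rV[R]_m) (xb : 'rV[R]_n) : Prop :=
  interior (linearized_set phi D xb) 0.

Definition RSRCQ (R : realType) (n m : nat) (phi : 'rV[R]_n -> 'rV[R]_m)
    (D : set 'rV[R]_m) (xb : 'rV[R]_n) (lam : 'rV[R]_m) : Prop :=
  limiting_normal D (phi xb) lam /\
  interior (linearized_set phi
    [set y | D y /\ dotv lam (y - phi xb) = 0] xb) 0.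

(* R^n x R^n is identified with R^(n + n) through row_mx. *)
Definition gph (R : realType) (n : nat) (F : 'rV[R]_n -> 'rV[R]_n) :
    set 'rV[R]_(n + n) :=
  range (fun x => row_mx x (F x)).

Definition subdiff2 (R : realType) (n : nat) (psi : 'rV[R]_n -> R)
    (xb u : 'rV[R]_n) : set 'rV[R]_n :=
  [set w | limiting_normal (gph (grad psi)) (row_mx xb (grad psi xb))
             (row_mx w (- u))].

(* Main.v *)
(** Since [D] is the origin, [f] and the Lagrangian [psi] agree on the feasible
    set, and [grad psi xb] is orthogonal to [x - xb] for every sparse [x] near
    [xb]: for a Frechet multiplier because the whole line through [xb] and [x]
    is sparse, for a Clarke one because all sparse points near [xb] have the
    support of [xb].  So along a sequence [xb + t_k v_k] of feasible points
    defining [u], the mean value theorem gives points [xb + s u] with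
    [s -> 0] at which [g := <u, grad psi>] satisfies
    [g (xb + s u) - g xb >= s (c <u, u> - o(1))].  A mean value inequality for
    proximal subgradients of the Lipschitz function [g], obtained by minimizing
    [g x - t q + N |x - xb - t s u|^2] over a ball times [[0, 1]], turns these
    slopes into bounded subgradients [v] of [g] near [xb] with
    [<v, u> >= c <u, u> - o(1)].  Each [(v, - u)] is a Frechet normal to the
    graph of [grad psi], and a cluster point of the [v] is the required [z]. *)

Require Import Defs.
From mathcomp Require Import all_boot all_order all_algebra.
From mathcomp Require Import all_classical all_reals all_analysis.
From mathcomp Require Import ring lra.
Set Implicit Arguments.
Unset Strict Implicit.
Import Order.TTheory GRing.Theory Num.Theory.
Import numFieldNormedType.Exports.
Local Open Scope classical_set_scope.
Local Open Scope ring_scope.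

(** * Inner product, comparison of the two norms, and Fréchet normals *)

Section DotProduct.
Context {R : realType} {n : nat}.
Implicit Types (x y z d u v w : 'rV[R]_n) (a K e r : R) (X : set 'rV[R]_n).

Lemma dotvC u v : dotv u v = dotv v u.
Proof. by apply: eq_bigr => i _; rewrite mulrC. Qed.

Lemma dotvDl u v w : dotv (u + v) w = dotv u w + dotv v w.
Proof. by rewrite -big_split; apply: eq_bigr => i _ /=; rewrite mxE mulrDl. Qed.

Lemma dotvDr u v w : dotv w (u + v) = dotv w u + dotv w v.
Proof. by rewrite dotvC dotvDl !(dotvC w). Qed.

Lemma dotvZl a u v : dotv (a *: u) v = a * dotv u v.
Proof. by rewrite mulr_sumr; apply: eq_bigr => i _; rewrite mxE mulrA. Qed.

Lemma dotvZr a u v : dotv u (a *: v) = a * dotv u v.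
Proof. by rewrite dotvC dotvZl dotvC. Qed.

Lemma dotvNl u v : dotv (- u) v = - dotv u v.
Proof. by rewrite -scaleN1r dotvZl mulN1r. Qed.

Lemma dotvNr u v : dotv u (- v) = - dotv u v.
Proof. by rewrite dotvC dotvNl dotvC. Qed.

Lemma dotvBl u v w : dotv (u - v) w = dotv u w - dotv v w.
Proof. by rewrite dotvDl dotvNl. Qed.

Lemma dotvBr u v w : dotv w (u - v) = dotv w u - dotv w v.
Proof. by rewrite dotvDr dotvNr. Qed.

Lemma dotv0l u : dotv 0 u = 0.
Proof. by rewrite -(scale0r 0) dotvZl mul0r. Qed.

Lemma dotv_delta u i : dotv u (delta_mx 0 i) = u 0 i.
Proof.
rewrite /dotv (bigD1 i) //= mxE !eqxx mulr1 big1 ?addr0 // => j ji.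
by rewrite mxE (negbTE ji) andbF mulr0.
Qed.

Lemma dotv_ge0 u : 0 <= dotv u u.
Proof. by apply: sumr_ge0 => i _; rewrite -expr2 sqr_ge0. Qed.

Lemma dotv_gt0 u : u != 0 -> 0 < dotv u u.
Proof.
move=> u0; rewrite lt_neqAle dotv_ge0 andbT eq_sym; apply: contra u0.
rewrite psumr_eq0 => [/allP h|i _]; last by rewrite -expr2 sqr_ge0.
apply/eqP/rowP => i; rewrite mxE; apply/eqP.
by have := h i (mem_index_enum i); rewrite mulf_eq0 orbb.
Qed.

Lemma sqr_enorm u : enorm u ^+ 2 = dotv u u.
Proof. by rewrite sqr_sqrtr // dotv_ge0. Qed.

Lemma enorm_ge0 u : 0 <= enorm u.
Proof. exact: sqrtr_ge0. Qed.

Lemma enorm_gt0 u : u != 0 -> 0 < enorm u.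
Proof. by move=> u0; rewrite sqrtr_gt0 dotv_gt0. Qed.

Lemma enormZ a u : enorm (a *: u) = `|a| * enorm u.
Proof.
by rewrite /enorm dotvZl dotvZr mulrA -expr2 sqrtrM ?sqr_ge0 // sqrtr_sqr.
Qed.

Lemma le_coord_norm u i : `|u 0 i| <= `|u|.
Proof.
rewrite [leRHS]/Num.Def.normr /= mx_normrE; apply/bigmax_geP; right.
by exists (0, i).
Qed.

(** The sup norm is attained at some coordinate, whose square is one term of the sum. *)
Lemma sqr_norm_le_dotv u : `|u| ^+ 2 <= dotv u u.
Proof.
have [->|] := eqVneq `|u| 0; first by rewrite expr0n dotv_ge0.
move=> /(@mx_norm_neq0 _ _ _ u)[[i j] /= uE].
rewrite [`|u|]uE ord1 real_normK ?num_real // /dotv (bigD1 j) //= -expr2.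
by rewrite lerDl sumr_ge0 // => k _; rewrite -expr2 sqr_ge0.
Qed.

Lemma dotv_le_norm u v : `|dotv u v| <= n%:R * `|u| * `|v|.
Proof.
rewrite (le_trans (ler_norm_sum _ _ _)) //.
rewrite (@le_trans _ _ (\sum_(i < n) `|u| * `|v|)) //.
  by apply: ler_sum => i _; rewrite normrM ler_pM // le_coord_norm.
by rewrite sumr_const card_ord -mulrA mulr_natl.
Qed.

(** The constant is crude: its square dominates [n], and it is positive even for [n = 0]. *)
Lemma enorm_le_norm u : enorm u <= (n%:R + 1) * `|u|.
Proof.
rewrite -(@ler_pXn2r _ 2) ?nnegrE ?enorm_ge0 ?mulr_ge0 ?addr_ge0 //.
rewrite sqr_enorm (le_trans (ler_norm _)) // (le_trans (dotv_le_norm _ _)) //.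
rewrite exprMn -mulrA -expr2 ler_wpM2r ?sqr_ge0 //.
by have : 0 <= n%:R :> R by []; nra.
Qed.

Lemma dotv_continuous (T : topologicalType) (f g : T -> 'rV[R]_n) :
  continuous f -> continuous g -> continuous (fun t => dotv (f t) (g t)).
Proof.
move=> cf cg; rewrite /dotv; elim: index_enum => [|i r IHr].
  by under eq_fun do rewrite big_nil; exact: cst_continuous.
under eq_fun do rewrite big_cons; move=> t; apply: cvgD (IHr t).
apply: cvgM.
  exact: (cvg_comp _ _ (cf t) (@coord_continuous _ _ _ 0 i (f t))).
exact: (cvg_comp _ _ (cg t) (@coord_continuous _ _ _ 0 i (g t))).
Qed.

(** The epsilon form of the upper limit. The puncture at [x] disappears because both sides of the
    inequality vanish at [y = x]. *)
Lemma frechet_normalP X x v :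
  frechet_normal X x v <->
  forall e, 0 < e ->
    \forall y \near x, X y -> dotv v (y - x) <= e * enorm (y - x).
Proof.
split=> [Nv e e0|h].
  have : (limf_esup (fun y : 'rV[R]_n =>
      (dotv v (y - x)%R / enorm (y - x)%R)%:E) (within X x^') < e%:E)%E.
    by apply: (le_lt_trans Nv); rewrite lte_fin.
  move=> /ereal_inf_lt[_ [V /= VX <-] Ve].
  have {}VX : \forall y \near x, y != x -> X y -> V y by exact: VX.
  apply: filterS VX => y Vy Xy.
  have [->|yx] := eqVneq y x.
    by rewrite subrr dotvC dotv0l mulr_ge0 ?enorm_ge0 // ltW.
  rewrite -ler_pdivrMr ?enorm_gt0 ?subr_eq0 // -lee_fin.
  apply: le_trans (ltW Ve); apply: ereal_sup_ubound; exists y => //.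
  exact: Vy.
apply/lee_addgt0Pr => e e0; rewrite add0e.
(* The required inequality is built into [V], so the supremum of the quotients over [V] is at most
   [e]. *)
pose V := [set y | X y -> y != x -> dotv v (y - x) <= e * enorm (y - x)]
  `&` X `&` [set y | y != x].
apply: (@le_trans _ _ (ereal_sup
    [set (dotv v (y - x)%R / enorm (y - x)%R)%:E | y in V])).
  apply: ereal_inf_lbound; exists V => //.
  suff : \forall y \near x, y != x -> X y -> V y by [].
  apply: filterS (h e e0) => y hy yx Xy.
  by do !split => //=; move=> _ _; exact: hy.
apply: ge_ereal_sup => _ [y [[hy Xy] yx] <-]; rewrite lee_fin.
by rewrite ler_pdivrMr ?enorm_gt0 ?subr_eq0 //; exact: hy.
Qed.

(** Points [x + r *: d] with small [r > 0] give [dotv v d <= 0], and the line also contains the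
    opposite direction. *)
Lemma frechet_normal_line X x v d : frechet_normal X x v ->
  (forall r, X (x + r *: d)) -> dotv v d = 0.
Proof.
have half w : frechet_normal X x v -> (forall r, X (x + r *: w)) ->
    dotv v w <= 0.
  move=> /frechet_normalP Nv Xw.
  apply/ler_addgt0Pr => e e0; rewrite add0r.
  (* After division by the step length the bound reads [e / (enorm w + 1) * enorm w], which is at
     most [e]. *)
  have e'0 : 0 < e / (enorm w + 1).
    by rewrite divr_gt0 // ltr_wpDl // enorm_ge0.
  have cl : x + r *: w @[r --> (0 : R)] --> x.
    suff : x + r *: w @[r --> (0 : R)] --> x + 0 *: w by rewrite scale0r addr0.
    apply: cvgD; first exact: cvg_cst.
    by apply: cvgZ; [exact: cvg_id|exact: cvg_cst].
  have /nbhs_ballP[r /= r0 rP] := cl _ (Nv _ e'0).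
  have /= : ball (0 : R) r (r / 2).
    rewrite /ball /= sub0r normrN gtr0_norm ?divr_gt0 //.
    by rewrite ltr_pdivrMr // ltr_pMr // ltr1n.
  move=> /rP /= /(_ (Xw _)).
  rewrite addrAC subrr add0r dotvZr enormZ gtr0_norm ?divr_gt0 // mulrCA.
  rewrite ler_pM2l ?divr_gt0 // => /le_trans; apply.
  rewrite mulrAC ler_pdivrMr ?ltr_wpDl ?enorm_ge0 //.
  by rewrite ler_pM2l // lerDl.
move=> Nv Xd; apply/eqP; rewrite eq_le half //= -oppr_le0 -dotvNr half // => r.
by rewrite scalerN -scaleNr.
Qed.

End DotProduct.

(** * A mean value inequality for proximal subgradients *)

Section ProximalMeanValue.
Context {R : realType} {n : nat}.
Implicit Types (a d c v p x : 'rV[R]_n) (K N e r t : R) (g : 'rV[R]_n -> R).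

Lemma ball_rVE a r x : ball a r x = (`|a - x| < r).
Proof. by rewrite mx_norm_ball. Qed.

Lemma compact_norm_le a r : compact [set x : 'rV[R]_n | `|x - a| <= r].
Proof.
apply: bounded_closed_compact.
  exists (r + `|a|); split => [|M rM x /= xr]; first by rewrite num_real.
  rewrite -(subrK a x) (le_trans (ler_normD _ _)) //.
  by rewrite (le_trans _ (ltW rM)) // lerD2r.
have cn : continuous (fun x : 'rV[R]_n => `|x - a|).
  move=> x; apply: (@cvg_norm _ _ _ (nbhs x) _ (fun x => x - a)).
  by apply: cvgB; [exact: cvg_id|exact: cvg_cst].
suff : closed ((fun x : 'rV[R]_n => `|x - a|) @^-1` [set y | y <= r]) by [].
by apply: preimage_closed => [x _|]; [exact: cn|exact: closed_le].
Qed.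

Lemma dotv_add_sqr u v : dotv (u + v) (u + v) =
  dotv u u + 2 * dotv u v + dotv v v :> R.
Proof. by rewrite !(dotvDl, dotvDr) (dotvC v u); ring. Qed.

(** Penalization: [Phi] is minimized over a ball times [[0, 1]], with [x] tied to the segment point
    [p t] by a quadratic penalty. At a minimizer [(c, t)], varying [x] makes [v = -2N w], where
    [w = c - p t], a proximal subgradient at [c], and varying [t] bounds [dotv v d] from below. *)
Lemma proximal_mean_value g a d K r e : continuous g -> 0 <= K -> 0 < e ->
  `|d| < r ->
  (forall x y, `|x - a| <= r -> `|y - a| <= r ->
     `|g x - g y| <= K * `|x - y|) ->
  exists c v N, [/\ `|c - a| <= `|d| + e, `|v| <= 2 * K, 0 <= N,
    g (a + d) - g a - e <= dotv v d
  & \forall x \near c, g c + dotv v (x - c) - N * dotv (x - c) (x - c) <= g x].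
Proof.
move=> cg K0 e0 dr gK.
have r0 : 0 < r by apply: le_lt_trans dr.
pose dl := Num.min e (r - `|d|).
have dl0 : 0 < dl by rewrite lt_min e0 subr_gt0.
have [dle dlr] : dl <= e /\ dl <= r - `|d| by rewrite /dl !ge_min !lexx orbT.
(* The minimizer will satisfy [N * |w| <= K]; this choice then makes both [|w|] and [K * |w|]
   smaller than [dl]. *)
have [N N0 Ndl] : exists2 N, 0 < N & N * dl = (K + 1) ^+ 2.
  exists ((K + 1) ^+ 2 / dl); last by rewrite divfK // gt_eqF.
  by rewrite divr_gt0 // exprn_gt0 // ltr_wpDl.
pose q := g (a + d) - g a - e.
pose p (t : R) := a + t *: d.
have pr t : 0 <= t <= 1 -> `|p t - a| <= `|d|.
  move=> /andP[t0 t1]; rewrite /p addrAC subrr add0r normrZ ger0_norm //.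
  by rewrite ler_piMl.
pose Phi (z : 'rV[R]_n * R) :=
  g z.1 - z.2 * q + N * dotv (z.1 - p z.2) (z.1 - p z.2).
pose A := [set x : 'rV[R]_n | `|x - a| <= r] `*` [set` `[(0 : R), 1]].
have cPhi : continuous Phi.
  have c1 : continuous (fst : 'rV[R]_n * R -> _) by move=> z; exact: cvg_fst.
  have c2 : continuous (snd : 'rV[R]_n * R -> _) by move=> z; exact: cvg_snd.
  have cd : continuous (fun z : 'rV[R]_n * R => z.1 - p z.2).
    move=> z; apply: cvgB; first exact: c1.
    apply: cvgD; first exact: cvg_cst.
    by apply: cvgZ; [exact: c2|exact: cvg_cst].
  move=> z; apply: cvgD.
    apply: cvgB; first exact: (cvg_comp _ _ (c1 z) (cg z.1)).
    by apply: cvgM; [exact: c2|exact: cvg_cst].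
  have cq := dotv_continuous cd cd.
  apply: cvgM; first exact: cvg_cst. exact: (cq z).
have [] := @compact_EVT_min _ R Phi A _ _ (continuous_subspaceT cPhi).
- exists (a, 0); split => /=; rewrite ?subrr ?normr0 ?(ltW r0) //.
  by rewrite in_itv /= lexx ler01.
- apply: compact_setX; [exact: compact_norm_le|exact: segment_compact].
move=> [c t] /set_mem[/= ca]; rewrite in_itv /= => t01 cmin.
have [t0 t1] := andP t01.
have Phimin x y : `|x - a| <= r -> 0 <= y <= 1 -> Phi (c, t) <= Phi (x, y).
  by move=> xr y01; apply: cmin; apply/mem_set; split => //=; rewrite in_itv.
have pra s : 0 <= s <= 1 -> `|p s - a| <= r.
  by move=> s01; rewrite (le_trans (pr _ s01)) // ltW.
pose w := c - p t.
(* Compare the minimizer with [(p t, t)], where the penalty vanishes. *)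
have wq : N * dotv w w <= K * `|w|.
  have := Phimin (p t) t (pra _ t01) t01.
  rewrite /Phi /= subrr dotv0l mulr0 addr0 -/w.
  have := gK _ _ (pra _ t01) ca; rewrite [`|p t - c|]distrC -/w.
  by rewrite ler_norml => /andP[_]; lra.
have Nw : N * `|w| <= K.
  have [->|w0] := eqVneq `|w| 0; first by rewrite mulr0.
  have {}w0 : 0 < `|w| by rewrite lt_neqAle eq_sym w0 normr_ge0.
  rewrite -(ler_pM2r w0) -mulrA -expr2 (le_trans _ wq) // ler_pM2l //.
  exact: sqr_norm_le_dotv.
have wdl : `|w| < dl.
  rewrite -(ltr_pM2l N0) Ndl (le_lt_trans Nw) //; nra.
have cad : `|c - a| < `|d| + dl.
  have -> : c - a = (p t - a) + w by rewrite /w [RHS]addrC addrA subrK.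
  by rewrite (le_lt_trans (ler_normD _ _)) // ler_ltD ?pr.
(* If [t = 1], comparison with [(a, 0)] forces [g (a + d) - g c >= e], whereas the Lipschitz bound
   gives at most [K * |w| < dl <= e]. The term [- e] in [q] serves this purpose. *)
have tlt1 : t < 1.
  rewrite lt_neqAle t1 andbT; apply/eqP => tE.
  have := Phimin a 0; rewrite subrr normr0 (ltW r0) lexx ler01 => /(_ isT isT).
  have p0 : p 0 = a by rewrite /p scale0r addr0.
  rewrite /Phi /= mul0r subr0 p0 subrr dotv0l mulr0 addr0.
  rewrite -/w tE mul1r /q.
  have := gK _ _ ca (pra _ t01).
  have p1 : p 1 = a + d by rewrite /p scale1r.
  rewrite -/w tE p1.
  rewrite ler_norml => /andP[+ _].
  have : K * `|w| < dl.
    rewrite -(ltr_pM2l N0) Ndl mulrCA (le_lt_trans (ler_wpM2l K0 Nw)) //; nra.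
  have := mulr_ge0 (ltW N0) (dotv_ge0 w); lra.
exists c, (- (2 * N) *: w), N; split.
- by rewrite (le_trans (ltW cad)) // lerD2l.
- by rewrite normrZ normrN gtr0_norm ?mulr_gt0 // -mulrA ler_pM2l.
- exact: ltW.
(* Since [t] may be [0], only increments [h > 0] are tried. The second bound on [h] keeps the
   quadratic remainder [N * h ^+ 2 * dotv d d] below [h * e1]. *)
- apply/ler_addgt0Pr => e1 e10; rewrite -/q.
  pose h := Num.min (1 - t) (e1 / (N * dotv d d + 1)).
  have Ndd : 0 < N * dotv d d + 1.
    by rewrite ltr_wpDl // mulr_ge0 ?dotv_ge0 // ltW.
  have h0 : 0 < h by rewrite lt_min subr_gt0 tlt1 divr_gt0.
  have [h1 h2] : h <= 1 - t /\ h <= e1 / (N * dotv d d + 1).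
    by rewrite /h !ge_min !lexx orbT.
  have := Phimin c (t + h) ca; rewrite addr_ge0 ?(ltW h0) //=.
  have -> : t + h <= 1 by lra.
  move=> /(_ isT); rewrite /Phi /= -/w.
  have -> : c - p (t + h) = w + (- h) *: d.
    by rewrite /w /p scalerDl addrA opprD addrA scaleNr.
  rewrite (dotv_add_sqr w) !dotvZr !dotvZl.
  rewrite ler_pdivlMr // in h2.
  have := mulr_ge0 (ltW N0) (dotv_ge0 d).
  move=> dd H.
  suff : h * q <= h * (- (2 * N) * dotv w d + e1) by rewrite ler_pM2l.
  nra.
(* The minimizer satisfies [|c - a| < |d| + dl <= r], so every [x] near [c] is a competitor;
   expanding the square around [w] gives the subgradient inequality. *)
near=> x.
have xa : `|x - a| <= r.
  rewrite -(subrK c x) -addrA (le_trans (ler_normD _ _)) //.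
  have : ball c (r - (`|d| + dl) + (`|d| + dl - `|c - a|)) x.
    by near: x; apply: nbhsx_ballx; lra.
  by rewrite ball_rVE distrC; lra.
have := Phimin x t xa t01; rewrite /Phi /= -/w.
have -> : x - p t = (x - c) + w by rewrite /w addrA subrK.
by rewrite dotv_add_sqr dotvZl (dotvC w); lra.
Unshelve. all: by end_near. Qed.

End ProximalMeanValue.

(** * From proximal subgradients to Fréchet normals of a graph *)

Section GraphNormal.
Context {R : realType} {n : nat}.
Implicit Types (c d u v w x : 'rV[R]_n) (N r : R) (F : 'rV[R]_n -> 'rV[R]_n).

Lemma dotv_row_mx v1 v2 w1 w2 :
  dotv (row_mx v1 v2) (row_mx w1 w2) = dotv v1 w1 + dotv v2 w2 :> R.
Proof.
by rewrite /dotv big_split_ord; congr (_ + _); apply: eq_bigr => i _;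
  rewrite ?row_mxEl ?row_mxEr.
Qed.

Lemma norm_row_mx_le v w r : `|v| <= r -> `|w| <= r -> `|row_mx v w| <= r :> R.
Proof.
move=> vr wr; rewrite [leLHS]/Num.Def.normr /= mx_normrE; apply: bigmax_le.
  exact: le_trans vr.
move=> [i j] _ /=; rewrite ord1; case: (split_ordP j) => k ->.
  by rewrite row_mxEl (le_trans (le_coord_norm _ _)).
by rewrite row_mxEr (le_trans (le_coord_norm _ _)).
Qed.

Lemma norm_row_mxl v w : `|v| <= `|row_mx v w| :> R.
Proof.
rewrite [leLHS]/Num.Def.normr /= mx_normrE; apply: bigmax_le => // -[i j] _ /=.
by rewrite ord1 -(row_mxEl v w) le_coord_norm.
Qed.

(** For an increment [z] of the graph, the hypothesis says that the pairing of [(v, -u)] with [z] is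
    at most [N |x - c|^2 <= N |z|^2], which is [o(|z|)]. *)
Lemma proximal_gph_normal F u v c N : 0 <= N ->
  (\forall x \near c,
     dotv u (F c) + dotv v (x - c) - N * dotv (x - c) (x - c) <=
     dotv u (F x)) ->
  frechet_normal (gph F) (row_mx c (F c)) (row_mx v (- u)).
Proof.
move=> N0 /nbhs_ballP[r /= r0 rP]; apply/frechet_normalP => e e0.
(* The second factor converts the sup norm on the product into the Euclidean norm; [N + 1] keeps the
   divisor positive. *)
have D0 : 0 < (N + 1) * ((n + n)%:R + 1) :> R.
  by rewrite mulr_gt0 // ltr_wpDl.
near=> y => -[x _ yE].
have : ball (row_mx c (F c)) (Num.min r (e / ((N + 1) * ((n + n)%:R + 1)))) y.
  by near: y; apply: nbhsx_ballx; rewrite lt_min r0 divr_gt0.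
rewrite ball_rVE distrC -yE opp_row_mx add_row_mx.
set z := row_mx _ _ => zlt.
have zr : `|z| < r by rewrite (lt_le_trans zlt) // ge_min lexx.
have ze : `|z| * ((N + 1) * ((n + n)%:R + 1)) <= e.
  by rewrite -ler_pdivlMr // (le_trans (ltW zlt)) // ge_min lexx orbT.
have xP : dotv u (F c) + dotv v (x - c) - N * dotv (x - c) (x - c) <=
    dotv u (F x).
  apply: rP; rewrite /= ball_rVE distrC (le_lt_trans _ zr) //.
  exact: norm_row_mxl.
have Ne : (N + 1) * enorm z <= e.
  rewrite (le_trans _ ze) // [leRHS]mulrC -mulrA ler_pM2l ?ltr_wpDl //.
  exact: enorm_le_norm.
have : N * dotv (x - c) (x - c) <= N * enorm z ^+ 2.
  by rewrite ler_wpM2l // sqr_enorm dotv_row_mx lerDl dotv_ge0.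
have := ler_wpM2r (enorm_ge0 z) Ne; have := sqr_ge0 (enorm z).
rewrite mulrDl mul1r mulrDl -!mulrA -!expr2 dotv_row_mx dotvNl (dotvBr (F x)).
lra.
Unshelve. all: by end_near. Qed.

End GraphNormal.

(** * Slopes of the gradient forced by quadratic growth *)

Section SecondOrder.
Context {R : realType} {n : nat}.
Implicit Types (psi : 'rV[R]_n -> R) (xb u v x : 'rV[R]_n) (c e r t K : R).

Lemma dotv_grad psi x v : dotv (grad psi x) v = 'd psi x v.
Proof.
rewrite {2}(row_sum_delta v) linear_sum; apply: eq_bigr => i _ /=.
by rewrite linearZ /= mxE mulrC.
Qed.

Lemma is_derive_line psi x v t : differentiable psi (x + t *: v) ->
  is_derive t 1 (fun s => psi (x + s *: v)) (dotv (grad psi (x + t *: v)) v).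
Proof.
move=> dpsi; have dv : derivable psi (x + t *: v) v by exact: diff_derivable.
have E : (fun h : R => h^-1 *: (psi (x + (h *: 1 + t) *: v) - psi (x + t *: v)))
    = fun h => h^-1 *: (psi (h *: v + (x + t *: v)) - psi (x + t *: v)).
  by apply/funext => h; rewrite [h *: 1]mulr1 scalerDl addrCA.
apply: DeriveDef.
  by move: dv; rewrite /derivable /= -E.
by rewrite dotv_grad -deriveE // /derive /= -E.
Qed.

Definition lipschitz_near (F : 'rV[R]_n -> 'rV[R]_n) xb :=
  exists K r, [/\ 0 <= K, 0 < r &
    forall x y, `|x - xb| <= r -> `|y - xb| <= r ->
      `|F x - F y| <= K * `|x - y|].

(** For a large [k], the mean value theorem along [w = v k], applied to [psi] minus the quadratic
    growth term, gives the slope in direction [w]. The Lipschitz bound on the gradient then allows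
    [w] to be replaced by [u]. *)
Lemma mean_slope psi xb u c (t : nat -> R) (v : nat -> 'rV[R]_n) :
  (forall x, differentiable psi x) -> lipschitz_near (grad psi) xb -> 0 <= c ->
  (forall k, 0 < t k) -> t @ \oo --> (0 : R) -> v @ \oo --> u ->
  (\forall k \near \oo, dotv (grad psi xb) (v k) = 0) ->
  (\forall k \near \oo,
     psi xb + 2^-1 * c * enorm (t k *: v k) ^+ 2 <= psi (xb + t k *: v k)) ->
  forall e, 0 < e -> exists s, [/\ 0 < s, s < e &
    s * (c * dotv u u - e) <= dotv (grad psi (xb + s *: u) - grad psi xb) u].
Proof.
move=> dpsi [K [r [K0 r0 lipK]]] c0 t0 tcv vcv crit growth e e0.
(* The slope obtained from direction [w], less the total cost of replacing [w] by [u]; it tends to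
   [c * dotv u u] as [w] tends to [u]. *)
pose m w := c * dotv w w - n%:R * K * `|u - w| * (`|w| + `|u|).
have cm : continuous m.
  have ci : continuous (fun w : 'rV[R]_n => w) by move=> w; exact: cvg_id.
  have cd := dotv_continuous ci ci.
  move=> w; apply: (@cvgB _ _ _ (nbhs w)).
    by apply: cvgM; [exact: cvg_cst|exact: (cd w)].
  apply: (@cvgM _ _ (nbhs w)); last first.
    by apply: cvgD; [apply: cvg_norm; exact: cvg_id|exact: cvg_cst].
  apply: (@cvgM _ _ (nbhs w)); first exact: cvg_cst.
  apply: (@cvg_norm _ _ _ (nbhs w)).
  by apply: cvgB; [exact: cvg_cst|exact: cvg_id].
have mu : m u = c * dotv u u by rewrite /m subrr normr0 mulr0 mul0r subr0.
have mcv : m (v k) @[k --> \oo] --> c * dotv u u.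
  by rewrite -mu; exact: (cvg_comp _ _ vcv (cm u)).
have u10 : 0 < `|u| + 1 by rewrite ltr_wpDl.
(* As [|w| <= |u| + 1], steps below [dl] keep [xb + s *: w] and [xb + s *: u] in the Lipschitz
   ball. *)
pose dl := Num.min e (r / (`|u| + 1)).
have dl0 : 0 < dl by rewrite lt_min e0 divr_gt0.
have : \forall k \near \oo, [/\ t k < dl, `|u - v k| < 1,
   c * dotv u u - e < m (v k), dotv (grad psi xb) (v k) = 0 &
   psi xb + 2^-1 * c * enorm (t k *: v k) ^+ 2 <= psi (xb + t k *: v k)].
  near=> k; split; near: k => //.
  - exact: (cvgr_lt _ tcv).
  - exact: (cvgr_dist_lt _ _ vcv).
  - by apply: (cvgr_gt _ mcv); rewrite ltrBlDr ltrDl.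
move=> [k _ /(_ k (leqnn k))] [].
move: (t k) (t0 k) (v k) => T T0 w Tdl uw mw crw grw.
have we : `|w| <= `|u| + 1.
  rewrite -lerBlDl (le_trans _ (ltW uw)) // distrC.
  exact: lerB_dist.
have Tr y : `|y| <= `|u| + 1 ->
    forall s, 0 <= s <= T -> `|xb + s *: y - xb| <= r.
  move=> yu s /andP[s0 sT]; rewrite addrAC subrr add0r normrZ ger0_norm //.
  rewrite (@le_trans _ _ (T * (`|u| + 1))) ?ler_pM //.
  by rewrite -ler_pdivlMr // (le_trans (ltW Tdl)) // ge_min lexx orbT.
pose a := 2^-1 * c * dotv w w.
pose h : R -> R := (fun s => psi (xb + s *: w)) - (a \*: (@id R) ^+ 2).
pose dh s := dotv (grad psi (xb + s *: w)) w - 2 * a * s.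
have hd (s : R) : is_derive s (1 : R) h (dh s).
  have := is_derive_line (dpsi (xb + s *: w)) => ?.
  apply: is_derive_eq.
  by rewrite /dh /GRing.scale /= expr1 mulr1; ring.
have [] := @MVT R h dh 0 T T0 (fun s _ => hd s).
  apply: continuous_subspaceT => s; apply: differentiable_continuous.
  by apply/derivable1_diffP.
move=> s; rewrite in_itv /= => /andP[s0 sT] hE.
(* The growth hypothesis says exactly that [h 0 <= h T]. *)
have dh0 : 0 <= dh s.
  rewrite -(pmulr_lge0 _ T0) -[T]subr0 -hE.
  have hz z : h z = psi (xb + z *: w) - a * z ^+ 2 by [].
  rewrite !hz scale0r addr0 expr0n /= mulr0 !subr0.
  move: grw; rewrite enormZ exprMn sqr_enorm real_normK ?num_real // /a; lra.
have sT' : 0 <= s <= T by rewrite (ltW s0) ltW.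
exists s; split => //.
  by rewrite (lt_trans sT) // (lt_le_trans Tdl) // ge_min lexx.
rewrite /dh in dh0; set g := grad psi in dh0 crw *.
have Lw : `|g (xb + s *: w) - g xb| <= K * (s * `|w|).
  rewrite (le_trans (lipK _ _ (Tr _ we _ sT') _)) ?subrr ?normr0 ?(ltW r0) //.
  by rewrite addrAC subrr add0r normrZ gtr0_norm.
have uu : `|u| <= `|u| + 1 by rewrite lerDl.
have Lu : `|g (xb + s *: u) - g (xb + s *: w)| <= K * (s * `|u - w|).
  rewrite (le_trans (lipK _ _ (Tr _ uu _ sT') (Tr _ we _ sT'))) //.
  by rewrite opprD addrACA subrr add0r -scalerBr normrZ gtr0_norm.
apply: (@le_trans _ _ (s * m w)); first by rewrite ler_pM2l // ltW.
move: (g (xb + s *: u)) (g (xb + s *: w)) (g xb) crw dh0 Lw Lu => A B G.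
move=> GwE BwE BG AB.
(* This identity uses [dotv G w = 0]. The first term carries the slope, and the other two are of
   order [s * |u - w|]. *)
have -> : dotv (A - G) u = dotv B w + dotv (A - B) u + dotv (B - G) (u - w).
  by rewrite !dotvBr !dotvBl GwE; ring.
have C1 : n%:R * `|B - G| * `|u - w| <= n%:R * (K * (s * `|w|)) * `|u - w|.
  by rewrite ler_wpM2r // ler_wpM2l.
have C2 : n%:R * `|A - B| * `|u| <= n%:R * (K * (s * `|u - w|)) * `|u|.
  by rewrite ler_wpM2r // ler_wpM2l.
have := le_trans (dotv_le_norm (A - B) u) C2.
have := le_trans (dotv_le_norm (B - G) (u - w)) C1.
rewrite !ler_norml => /andP[B1 _] /andP[B2 _].
move: BwE B1 B2; rewrite /m /a.
move: (dotv B w) (dotv w w) (dotv (B - G) _) (dotv (A - B) _) => x1 x2 x3 x4.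
lra.
Unshelve. all: by end_near. Qed.

End SecondOrder.

(** * Approximate subgradients and their cluster points *)

Section Subdifferential.
Context {R : realType} {n : nat}.
Implicit Types (psi : 'rV[R]_n -> R) (xb u v x : 'rV[R]_n) (a e r s : R).

(** The proximal mean value inequality is applied to [g = dotv u (grad psi)] on the segment from
    [xb] to [xb + s *: u]. The bound [M] is chosen before [e], so that compactness can be used
    afterwards. *)
Lemma approximate_subgradient psi xb u a :
  continuous (grad psi) -> lipschitz_near (grad psi) xb ->
  (forall e, 0 < e -> exists s, [/\ 0 < s, s < e &
     s * (a - e) <= dotv (grad psi (xb + s *: u) - grad psi xb) u]) ->
  exists M, forall e, 0 < e -> exists c v,
    [/\ `|c - xb| <= e, `|v| <= M, a - e <= dotv v u &
        frechet_normal (gph (grad psi)) (row_mx c (grad psi c))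
          (row_mx v (- u))].
Proof.
move=> cF [K [r [K0 r0 lipK]]] slope.
move: (grad psi) cF lipK slope => F cF lipK slope.
pose g x := dotv u (F x).
have cg : continuous g by apply: dotv_continuous cF; exact: cst_continuous.
pose L := n%:R * `|u| * K.
have L0 : 0 <= L by rewrite !mulr_ge0.
have gL x y : `|x - xb| <= r -> `|y - xb| <= r -> `|g x - g y| <= L * `|x - y|.
  move=> xr yr; rewrite -dotvBr (le_trans (dotv_le_norm _ _)) // -[leRHS]mulrA.
  by rewrite ler_wpM2l ?mulr_ge0 // lipK.
exists (2 * L) => e e0.
have u0 : 0 < `|u| + 1 by rewrite ltr_wpDl.
(* Half of the error budget: the slope loses [b], the mean value inequality with error [s * b] loses
   another [b] after division by [s], and [2 * b <= e]. *)
pose b := Num.min r e / (2 * (`|u| + 1)).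
have b0 : 0 < b by rewrite divr_gt0 ?lt_min ?r0 // mulr_gt0.
have [bu2 bu1] : b * (2 * (`|u| + 1)) <= e /\ b * (2 * (`|u| + 1)) <= r.
  by rewrite /b divfK ?gt_eqF ?mulr_gt0 // !ge_min !lexx orbT.
have be : 2 * b <= e.
  by rewrite (le_trans _ bu2) // mulrC ler_pM2l // ler_peMr // lerDr.
have [s [s0 sb sl]] := slope (Num.min 1 b) ltac:(by rewrite lt_min ltr01).
have [s1 sb'] : s < 1 /\ s < b by move: sb; rewrite lt_min => /andP[].
have su : `|s *: u| = s * `|u| by rewrite normrZ gtr0_norm.
have su_b : s * `|u| <= b * `|u| by rewrite ler_wpM2r // ltW.
have bur : b * `|u| < r.
  by have := mulr_ge0 (ltW b0) (normr_ge0 u); lra.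
have bue : b * `|u| + b <= e.
  by have := mulr_ge0 (ltW b0) (normr_ge0 u); lra.
have [||c [v [N [cxb vL N0 vd sub]]]] :=
  @proximal_mean_value R n g xb (s *: u) L r (s * b) cg L0 _ _ gL.
- by rewrite mulr_gt0.
- by rewrite su (le_lt_trans su_b).
exists c, v; split => //.
- rewrite (le_trans cxb) // su (le_trans _ bue) // lerD // ler_piMl // ltW //.
- have : s * (a - b) - s * b <= s * dotv v u.
    rewrite -dotvZr (le_trans _ vd) // lerD2r -[leRHS]dotvBr dotvC.
    by rewrite (le_trans _ sl) // ler_pM2l // lerD2l lerN2 ge_min lexx orbT.
  rewrite -mulrBr ler_pM2l //; lra.
exact: proximal_gph_normal sub.
Qed.

(** The vectors [v] stay in a compact ball, and limits of Fréchet normals at graph points converging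
    to the base point are limiting normals. *)
Lemma subdiff2_of_approximate psi xb u a M :
  continuous (grad psi) ->
  (forall e, 0 < e -> exists c v,
    [/\ `|c - xb| <= e, `|v| <= M, a - e <= dotv v u &
        frechet_normal (gph (grad psi)) (row_mx c (grad psi c))
          (row_mx v (- u))]) ->
  exists z, subdiff2 psi xb u z /\ a <= dotv z u.
Proof.
rewrite /subdiff2; move: (grad psi) => F cF approx.
have {approx} /choice[cv cvP] : forall k : nat, exists p : 'rV[R]_n * 'rV[R]_n,
    [/\ `|p.1 - xb| <= k.+1%:R^-1, `|p.2| <= M, a - k.+1%:R^-1 <= dotv p.2 u &
     frechet_normal (gph F) (row_mx p.1 (F p.1)) (row_mx p.2 (- u))].
  move=> k; have [c [v H]] := approx k.+1%:R^-1 ltac:(by rewrite invr_gt0).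
  by exists (c, v).
have [|z [_ clz]] := @compact_norm_le R n 0 M (snd \o cv @ \oo) _.
  by exists 0%N => // k _ /=; rewrite subr0; case: (cvP k).
(* A cluster point is approached within every tail. Having [f j >= j] suffices for convergence,
   without monotonicity of [f]. *)
have /choice[f fP] : forall j : nat, exists k : nat,
    (j <= k)%N /\ `|z - (cv k).2| < j.+1%:R^-1.
  move=> j; have jp : 0 < j.+1%:R^-1 :> R by rewrite invr_gt0.
  have [] := clz ((snd \o cv) @` [set k | (j <= k)%N]) (ball z j.+1%:R^-1).
  - by exists j => // k jk; exists k.
  - exact: nbhsx_ballx.
  by move=> _ [[k jk <-]]; rewrite ball_rVE => ?; exists k.
have invle j : (f j).+1%:R^-1 <= j.+1%:R^-1 :> R.
  by rewrite lef_pV2 ?posrE // ler_nat ltnS; case: (fP j).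
have hcv (y : nat -> 'rV[R]_n) (l : 'rV[R]_n) :
    (forall j, `|l - y j| <= j.+1%:R^-1) ->
    y @ \oo --> l.
  move=> yl; apply/cvgrPdist_le => e e0.
  have := near_infty_natSinv_lt (PosNum e0); apply: filterS => j /ltW.
  exact: le_trans.
have ccv : (cv (f j)).1 @[j --> \oo] --> xb.
  apply: hcv => j; rewrite distrC (le_trans _ (invle j)) //.
  by case: (cvP (f j)).
have vcv : (cv (f j)).2 @[j --> \oo] --> z.
  by apply: hcv => j; apply/ltW; case: (fP j).
have Fcv : F (cv (f j)).1 @[j --> \oo] --> F xb := cvg_comp _ _ ccv (cF xb).
have rcv (y1 y2 : nat -> 'rV[R]_n) (l1 l2 : 'rV[R]_n) :
    y1 @ \oo --> l1 -> y2 @ \oo --> l2 ->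
    row_mx (y1 j) (y2 j) @[j --> \oo] --> row_mx l1 l2.
  move=> y1l y2l; apply/cvgrPdist_le => e e0.
  near=> j; rewrite opp_row_mx add_row_mx norm_row_mx_le //; near: j.
    by apply: (iffLR (cvgrPdist_le _ _) y1l).
  by apply: (iffLR (cvgrPdist_le _ _) y2l).
exists z; split.
  exists (fun j => row_mx (cv (f j)).1 (F (cv (f j)).1)).
  exists (fun j => row_mx (cv (f j)).2 (- u)); split.
  - by move=> j; exists (cv (f j)).1.
  - exact: rcv.
  - by move=> j; case: (cvP (f j)).
  - by apply: rcv => //; exact: cvg_cst.
rewrite leNgt; apply/negP => za.
pose e := (a - dotv z u) / 2.
have e0 : 0 < e by rewrite divr_gt0 // subr_gt0.
have du : continuous (fun v => dotv v u).
  by apply: dotv_continuous; [move=> v; exact: cvg_id|exact: cst_continuous].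
have dcv : dotv (cv (f j)).2 u @[j --> \oo] --> dotv z u :=
  cvg_comp _ _ vcv (du z).
have : \forall j \near \oo,
    dotv (cv (f j)).2 u < dotv z u + e /\ j.+1%:R^-1 < e.
  near=> j; split; near: j.
    by apply: (cvgr_lt _ dcv); rewrite ltrDl.
  exact: near_infty_natSinv_lt (PosNum e0).
move=> [j _ /(_ j (leqnn j))][lt1 lt2].
have [_ _ + _] := cvP (f j).
move: lt1 lt2 (invle j); rewrite /e.
by move: (dotv _ u) (dotv z u) j.+1%:R^-1 (f j).+1%:R^-1 => x1 x2 x3 x4; lra.
Unshelve. all: by end_near. Qed.

Lemma second_order_necessary psi xb u a (t : nat -> R) (v : nat -> 'rV[R]_n) :
  C1 psi -> lipschitz_near (grad psi) xb -> 0 <= a ->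
  (forall k, 0 < t k) -> t @ \oo --> (0 : R) -> v @ \oo --> u ->
  (\forall k \near \oo, dotv (grad psi xb) (v k) = 0) ->
  (\forall k \near \oo,
     psi xb + 2^-1 * a * enorm (t k *: v k) ^+ 2 <= psi (xb + t k *: v k)) ->
  exists z, subdiff2 psi xb u z /\ a * dotv u u <= dotv z u.
Proof.
move=> [dpsi cF] lipF a0 t0 tcv vcv crit growth.
have [M] := approximate_subgradient cF lipF
  (mean_slope dpsi lipF a0 t0 tcv vcv crit growth).
exact: subdiff2_of_approximate.
Qed.

End Subdifferential.

(** * Regularity of the Lagrangian *)

Section LagrangianRegularity.
Context {R : realType} {n : nat}.
Implicit Types (f g psi : 'rV[R]_n -> R) (xb x : 'rV[R]_n) (a : R).

Lemma C11_lipschitz_near psi xb :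
  C11_around psi xb -> lipschitz_near (grad psi) xb.
Proof.
move=> [U [_ Uxb _ /(_ _ Uxb)[V xbV lipV]]].
have [K K0 KP] := pinfty_ex_gt0 lipV.
have /nbhs_ballP[r /= r0 rV] := xbV.
(* Halving the radius puts the closed ball inside the open one. *)
exists K, (r / 2); split; rewrite ?(ltW K0) ?divr_gt0 // => x y xr yr.
have Vr z : `|z - xb| <= r / 2 -> V z.
  move=> zr; apply: rV; rewrite ball_rVE distrC (le_lt_trans zr) //.
  by rewrite ltr_pdivrMr // ltr_pMr // ltr1n.
by apply: (KP (x, y)); split => /=; exact: Vr.
Qed.

Lemma gradDZ f g a x : differentiable f x -> differentiable g x ->
  grad (fun y => f y + a * g y) x = grad f x + a *: grad g x.
Proof.
move=> df dg; apply/rowP => i; rewrite !mxE.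
have dag : differentiable (a \*: g) x by exact: differentiableZ.
apply: etrans (congr1 (@^~ (delta_mx 0 i)) (diffD df dag)) _.
by congr (_ + _); exact: (congr1 (@^~ (delta_mx 0 i)) (diffZ a dg)).
Qed.

Lemma C1_DZ f g a : C1 f -> C1 g -> C1 (fun y => f y + a * g y).
Proof.
move=> [df cf] [dg cg]; split => [x|].
  by apply: differentiableD => //; exact: differentiableZ.
have -> : grad (fun y => f y + a * g y) = fun x => grad f x + a *: grad g x.
  by apply/funext => x; exact: gradDZ.
move=> x; apply: (@cvgD _ _ _ (nbhs x)); first exact: cf.
by apply: (@cvgZ _ _ _ (nbhs x)); [exact: cvg_cst|exact: cg].
Qed.

Lemma lipschitz_near_DZ f g a xb : C1 f -> C1 g ->
  lipschitz_near (grad f) xb -> lipschitz_near (grad g) xb ->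
  lipschitz_near (grad (fun y => f y + a * g y)) xb.
Proof.
move=> [df _] [dg _] [K [r [K0 r0 lf]]] [K' [r' [K'0 r'0 lg]]].
exists (K + `|a| * K'), (Num.min r r').
split; rewrite ?addr_ge0 ?mulr_ge0 ?lt_min ?r0 // => x y.
rewrite !le_min => /andP[xr xr'] /andP[yr yr']; rewrite !gradDZ //.
rewrite opprD addrACA -scalerBr (le_trans (ler_normD _ _)) // mulrDl.
by rewrite lerD ?lf // normrZ -mulrA ler_wpM2l // lg.
Qed.

Lemma lagrangian_regular m f (phi : 'rV[R]_n -> 'rV[R]_m) lam xb :
  C1 f -> C1_vec phi -> C11_around f xb -> C11_vec_around phi xb ->
  C1 (lagrangian f phi lam) /\ lipschitz_near (grad (lagrangian f phi lam)) xb.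
Proof.
move=> f1 phi1 /C11_lipschitz_near fl phil; rewrite /lagrangian /dotv.
(* Induction on the list of summed indices: the empty sum leaves [f], and each step adds one
   multiple of a component of [phi]. *)
elim: index_enum => [|j r [IH1 IHl]].
  by under eq_fun do rewrite big_nil addr0.
under eq_fun do rewrite big_cons addrCA addrC.
split; first exact: (C1_DZ (lam 0 j) IH1 (phi1 j)).
apply: (lipschitz_near_DZ (lam 0 j) IH1 (phi1 j) IHl).
exact: C11_lipschitz_near (phil j).
Qed.

End LagrangianRegularity.

(** * Normals to the set of sparse vectors *)

Section SparseNormals.
Context {R : realType} {n : nat}.
Implicit Types (x y d v xb : 'rV[R]_n) (s : nat).

Lemma near_supp_sub xb : \forall x \near xb, supp xb \subset supp x.
Proof.
have : \forall x \near xb, forall i, i \in supp xb -> i \in supp x.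
  apply: (@filter_forall _ _ (fun i x => i \in supp xb -> i \in supp x)
    (nbhs xb)) => i; case: (boolP (i \in supp xb)) => [|_]; last first.
    exact: nearW.
  rewrite inE => xi; have xi0 : 0 < `|xb 0 i| by rewrite normr_gt0.
  have := nbhsx_ballx xb _ xi0; apply: filterS => x; rewrite ball_rVE => xl _.
  rewrite inE; apply: contraTneq xl => xi'; rewrite -leNgt.
  by rewrite (le_trans _ (le_coord_norm _ i)) // !mxE xi' subr0.
by apply: filterS => x xP; apply/fintype.subsetP.
Qed.

(** The line through [xb] and [x] consists of vectors supported in [supp x], hence sparse. *)
Lemma frechet_normal_sparse_orth s xb x v : (l0 x <= s)%N ->
  supp xb \subset supp x -> frechet_normal (@sparse R n s) xb v ->
  dotv v (x - xb) = 0.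
Proof.
move=> xs xbx Nv; apply: (frechet_normal_line Nv) => r.
rewrite /sparse /= (leq_trans _ xs) // subset_leq_card //.
apply/fintype.subsetP => i; apply: contraLR => ix.
have := contra (fintype.subsetP xbx i) ix; move: ix; rewrite !inE !negbK !mxE.
by move=> /eqP-> /eqP->; rewrite subrr mulr0 addr0.
Qed.

(** Eventually [i] lies in the support of [y k], so moving [y k] along the [i]-th unit vector stays
    sparse and [w k] has zero [i]-th coordinate. *)
Lemma limiting_normal_sparse_coord s xb v i : l0 xb = s -> xb 0 i != 0 ->
  limiting_normal (@sparse R n s) xb v -> v 0 i = 0.
Proof.
move=> xbs xi [y [w [yS ycv wN wcv]]].
have wicv : w k 0 i @[k --> \oo] --> v 0 i.
  exact: (cvg_comp _ _ wcv (@coord_continuous _ _ _ 0 i v)).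
apply: (cvg_unique _ wicv) => //; apply: cvg_near_cst.
have : \forall k \near \oo, supp xb \subset supp (y k).
  exact: (ycv _ (near_supp_sub xb)).
apply: filterS => k xby.
rewrite -dotv_delta; apply: (frechet_normal_line (wN k)) => r.
rewrite /sparse /= (leq_trans _ (yS k)) // subset_leq_card //.
have iy : i \in supp (y k) by apply: (fintype.subsetP xby); rewrite inE.
apply/fintype.subsetP => j; have [->//|ji] := eqVneq j i.
by rewrite !inE !mxE (negbTE ji) andbF mulr0 addr0.
Qed.

(** A vanishing coordinate defines a closed convex set, so the property passes from limiting normals
    to the closed convex hull. *)
Lemma clarke_normal_sparse_coord s xb v i : l0 xb = s -> xb 0 i != 0 ->
  clarke_normal (@sparse R n s) xb v -> v 0 i = 0.
Proof.
move=> xbs xi.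
pose H : set 'rV[R]_n := [set w | w 0 i = 0].
have closedH : closed H.
  suff : closed ((fun w : 'rV[R]_n => w 0 i) @^-1` [set 0]) by [].
  apply: preimage_closed => [w _|]; first exact: coord_continuous.
  exact: closed_eq.
suff NH : clarke_normal (@sparse R n s) xb `<=` H by exact: NH.
rewrite [X in _ `<=` X](iffLR (closure_id _) closedH).
apply: closure_subset; apply: smallest_sub.
  move=> x y lam; rewrite !inE /H /= => xi0 yi0.
  by rewrite !mxE xi0 yi0 !mulr0 addr0.
by move=> w; exact: limiting_normal_sparse_coord.
Qed.

End SparseNormals.

(** * Second-order conditions for the sparse problem *)

(** Common core of the three claims: [a = 0] encodes local minimality, [a > 0] an isolated solution
    of order 2. Growth of [f] transfers to the Lagrangian because [phi] vanishes at feasible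
    points. *)
Lemma second_order_contingent (R : realType) (n m s : nat)
  (f : 'rV[R]_n -> R) (phi : 'rV[R]_n -> 'rV[R]_m) (lam : 'rV[R]_m)
  (xb u : 'rV[R]_n) (a : R) :
  C1 f -> C1_vec phi -> C11_around f xb -> C11_vec_around phi xb ->
  0 <= a -> feasible s phi [set 0] xb ->
  (\forall x \near xb, feasible s phi [set 0] x ->
     f xb + 2^-1 * a * enorm (x - xb) ^+ 2 <= f x) ->
  (\forall x \near xb, (l0 x <= s)%N ->
     dotv (grad (lagrangian f phi lam) xb) (x - xb) = 0) ->
  contingent_cone (feasible s phi [set 0]) xb u ->
  exists z, subdiff2 (lagrangian f phi lam) xb u z /\ a * dotv u u <= dotv z u.
Proof.
move=> f1 phi1 f11 phi11 a0 [phixb _] growth crit [t [v [t0 tcv vcv feas]]].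
have [L1 Ll] := lagrangian_regular lam f1 phi1 f11 phi11.
have xcv : xb + t k *: v k @[k --> \oo] --> xb.
  suff : xb + t k *: v k @[k --> \oo] --> xb + 0 *: u by rewrite scale0r addr0.
  by apply: cvgD; [exact: cvg_cst|exact: cvgZ].
have LE x : feasible s phi [set 0] x -> lagrangian f phi lam x = f x.
  by move=> [phix _]; rewrite /lagrangian phix dotvC dotv0l addr0.
have sub0 k : xb + t k *: v k - xb = t k *: v k by rewrite addrAC subrr add0r.
apply: (second_order_necessary L1 Ll a0 t0 tcv vcv).
  have : \forall k \near \oo, (l0 (xb + t k *: v k) <= s)%N ->
      dotv (grad (lagrangian f phi lam) xb) (xb + t k *: v k - xb) = 0.
    exact: (xcv _ crit).
  apply: filterS => k /(_ (feas k).2); rewrite sub0 dotvZr => /eqP.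
  by rewrite mulf_eq0 gt_eqF //= => /eqP.
have : \forall k \near \oo, feasible s phi [set 0] (xb + t k *: v k) ->
    f xb + 2^-1 * a * enorm (xb + t k *: v k - xb) ^+ 2 <= f (xb + t k *: v k).
  exact: (xcv _ growth).
apply: filterS => k /(_ (feas k)); rewrite sub0 (LE _ (feas k)).
by rewrite /lagrangian phixb (dotvC lam) dotv0l addr0.
Qed.

Lemma LambdaS_critical (R : realType) (n m s : nat) (f : 'rV[R]_n -> R)
  (phi : 'rV[R]_n -> 'rV[R]_m) (D : set 'rV[R]_m) (xb : 'rV[R]_n) lam :
  LambdaS s f phi D xb lam ->
  \forall x \near xb, (l0 x <= s)%N ->
    dotv (grad (lagrangian f phi lam) xb) (x - xb) = 0.
Proof.
move=> [_ N _]; apply: filterS (near_supp_sub xb) => x xbx xs.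
by apply/eqP; rewrite -oppr_eq0 -dotvNl (frechet_normal_sparse_orth xs xbx N).
Qed.

Lemma LambdaC_critical (R : realType) (n m s : nat) (f : 'rV[R]_n -> R)
  (phi : 'rV[R]_n -> 'rV[R]_m) (D : set 'rV[R]_m) (xb : 'rV[R]_n) lam :
  l0 xb = s -> LambdaC s f phi D xb lam ->
  \forall x \near xb, (l0 x <= s)%N ->
    dotv (grad (lagrangian f phi lam) xb) (x - xb) = 0.
Proof.
move=> xbs [_ N _]; apply: filterS (near_supp_sub xb) => x xbx xs.
(* The support of [xb] already has [s] elements. Each term of the inner product then vanishes: on
   the support through the gradient, off it through [x - xb]. *)
have suppE : supp xb = supp x.
  by apply/eqP; rewrite finset.eqEcard xbx /= -!/(l0 _) xbs.
apply: big1 => i _; case: (boolP (i \in supp xb)) => [|ixb].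
  rewrite inE => xi; have := clarke_normal_sparse_coord xbs xi N.
  by rewrite mxE => /eqP; rewrite oppr_eq0 => /eqP->; rewrite mul0r.
have := ixb; rewrite {1}suppE; move: ixb; rewrite !inE !negbK !mxE.
by move=> /eqP-> /eqP->; rewrite subrr mulr0.
Qed.

Unset Implicit Arguments.

Theorem theorem3p1 (R : realType) (n m s : nat)
  (hn : (1 <= n)%N) (hm : (1 <= m)%N) (hs : (0 < s < n)%N)
  (f : 'rV[R]_n -> R) (phi : 'rV[R]_n -> 'rV[R]_m)
  (f_C1 : C1 f) (phi_C1 : C1_vec phi)
  (D : set 'rV[R]_m) (hD : D = [set 0])
  (xb : 'rV[R]_n) (xb_neq0 : xb != 0)
  (xb_sol : local_solution f (feasible s phi D) xb)
  (f_C11 : C11_around f xb) (phi_C11 : C11_vec_around phi xb) :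
  (* (i) *)
  (RRCQ phi D xb -> l0 xb = s ->
     forall u, contingent_cone (feasible s phi D) xb u ->
     forall lam, LambdaC s f phi D xb lam ->
     exists z, subdiff2 (lagrangian f phi lam) xb u z /\ 0 <= dotv z u)
  /\
  (* (ii) *)
  (forall lam, LambdaS s f phi D xb = [set lam] -> RSRCQ phi D xb lam ->
     forall u, contingent_cone (feasible s phi D) xb u ->
     exists z, subdiff2 (lagrangian f phi lam) xb u z /\ 0 <= dotv z u)
  /\
  (* (iii) *)
  (isolated_solution2 f (feasible s phi D) xb ->
     forall lam, LambdaS s f phi D xb = [set lam] -> RSRCQ phi D xb lam ->
     forall u, contingent_cone (feasible s phi D) xb u -> u != 0 ->
     exists z, subdiff2 (lagrangian f phi lam) xb u z /\ 0 < dotv z u).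
Proof.
subst D.
have [xb_feas xb_min] := xb_sol.
(* Local minimality written as quadratic growth with constant [0]. *)
have growth0 : \forall x \near xb, feasible s phi [set 0] x ->
    f xb + 2^-1 * 0 * enorm (x - xb) ^+ 2 <= f x.
  by apply: filterS xb_min => x; rewrite mulr0 mul0r addr0.
have nec lam u := @second_order_contingent R n m s f phi lam xb u 0
  f_C1 phi_C1 f_C11 phi_C11 (lexx 0) xb_feas growth0.
split; [|split].
- move=> _ xbs u Tu lam Llam.
  have [z [zsub]] := nec lam u (LambdaC_critical xbs Llam) Tu.
  by rewrite mul0r => zu; exists z.
- move=> lam Llam _ u Tu.
  have lamS : LambdaS s f phi [set 0] xb lam by rewrite Llam.
  have [z [zsub]] := nec lam u (LambdaS_critical lamS) Tu.
  by rewrite mul0r => zu; exists z.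
move=> [_ [c c0 growth]] lam Llam _ u Tu u0.
have lamS : LambdaS s f phi [set 0] xb lam by rewrite Llam.
have [z [zsub zu]] := second_order_contingent f_C1 phi_C1 f_C11 phi_C11
  (ltW c0) xb_feas growth (LambdaS_critical lamS) Tu.
by exists z; split=> //; rewrite (lt_le_trans _ zu) // mulr_gt0 // dotv_gt0.
Qed.
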